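(* Let $\theta\in(0,1)$ be irrational with continued fraction expansion $\theta=[a_1,a_2,a_3,\ldots]$. Then $H^*_{\theta}=\{0\}$ if and only if all partial quotients of $\theta$ of odd index are even, i.e. $a_{2i+1}$ is even for every $i\ge 0$.
   Context: Let $S^1=\mathbb{R}/\mathbb{Z}$ be the unit circle, identified with $[0,1)$ with addition modulo one. For irrational $\theta$ define $f(x)=\chi_{[0,1/2]}(x)-\chi_{(1/2,1)}(x)$ ($x\in[0,1)$), $T(x)=x+\theta \bmod 1$, and $S_n(x)=\sum_{i=0}^{n-1} f(T^i(x))$. The strictly heavy set is $H^*_{\theta}=\{x\in[0,1): S_n(x)>0 \text{ for all } n=1,2,\ldots\}$. The notation $[a_1,a_2,a_3,\ldots]$ denotes the continued fraction $\cfrac{1}{a_1+\cfrac{1}{a_2+\cdots}}$ with positive integer partial quotients. *)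

(* Defs.v *)
From HB Require Import structures.
From mathcomp Require Import all_boot all_order all_algebra.
From mathcomp Require Import all_classical all_reals all_analysis.
Set Implicit Arguments.
Unset Strict Implicit.
Unset Printing Implicit Defensive.
Import Order.TTheory GRing.Theory Num.Theory.
Import numFieldNormedType.Exports.
Local Open Scope classical_set_scope.
Local Open Scope ring_scope.

(* The circle R/Z is represented by the real interval [0, 1[; the functions
   below are total on R, but only their values on [0, 1[ matter. *)
Definition circle_f {R : realType} (x : R) : R :=
  \1_(`[0, 2^-1]) x - \1_(`]2^-1, 1[) x.

Definition rotation {R : realType} (theta x : R) : R :=
  (x + theta) - (Num.floor (x + theta))%:~R.

Definition birkhoff_sum {R : realType} (theta : R) (n : nat) (x : R) : R :=
  \sum_(0 <= i < n) circle_f (iter i (rotation theta) x).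

Definition strictly_heavy {R : realType} (theta : R) : set R :=
  [set x : R | (0 <= x < 1) /\
           forall n : nat, (1 <= n)%N -> 0 < birkhoff_sum theta n x].

(* [cfrac_from a k n] is 1/(a_k + 1/(a_{k+1} + ... + 1/a_{k+n-1})), with [n]
   levels; for [n = 0] it is 0. *)
Fixpoint cfrac_from {R : realType} (a : nat -> nat) (k n : nat) : R :=
  if n is m.+1 then ((a k)%:R + cfrac_from a k.+1 m)^-1 else 0.

(* theta = [a_1, a_2, a_3, ...] with positive integer partial quotients.  The
   sequence is indexed from 1: the value [a 0] is irrelevant. *)
Definition has_cfrac {R : realType} (theta : R) (a : nat -> nat) : Prop :=
  (forall i : nat, (1 <= i)%N -> (1 <= a i)%N) /\
  (fun n : nat => cfrac_from a 1 n : R) @ \oo --> theta.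

(* Main.v *)
Require Import Defs.
From mathcomp Require Import all_boot all_order all_algebra.
From mathcomp Require Import all_classical all_reals all_analysis.
From mathcomp Require Import zify ring lra.
Import Order.TTheory GRing.Theory Num.Theory.
Import numFieldNormedType.Exports.
Set Implicit Arguments.
Unset Strict Implicit.
Local Open Scope classical_set_scope.
Local Open Scope ring_scope.

(** Renormalization.  Suppose [a_1 = 2 k] is even, put [theta_1 = [a_2, ...]],
    [theta_2 = [a_3, ...]] and [delta = 1 - 2 k theta = theta * theta_1].  Cut
    an orbit into turns of the circle, each starting in [[0, theta[]: the turn
    from [y] has Birkhoff sum [1] if [y <= delta / 2], [-1] if
    [delta / 2 < y < delta], and [0] otherwise.  Hence the first return to
    [[0, delta[], rescaled by [1 / delta], is the rotation by [theta_2], with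
    [f] itself as the sum over an excursion, and no nonempty partial sum along
    an excursion is below the total one.  Moreover the part of a turn from a
    point of [[delta, 1[] onwards has sum [<= 0].  So the strictly heavy set of
    [theta] is [delta] times that of [theta_2], and [delta <= 1 / 2]: when all
    partial quotients of odd index are even it shrinks to [{0}].  If
    [a_1 = 2 k + 1] is odd, the first turn from [0] has sum [0], so that [0] is
    not strictly heavy. *)

(** * Step function, rotation and Birkhoff sums *)

Lemma circle_fE (R : realType) (x : R) : 0 <= x < 1 ->
  circle_f x = if x <= 2^-1 then 1 else -1.
Proof.
move=> /andP[x0 x1]; rewrite /circle_f !indicE !mem_setE !in_itv /= x0 x1.
by case: leP => _ /=; rewrite ?subr0 ?sub0r.
Qed.

Lemma rotation_lt1 (R : realType) (theta x : R) :
  0 <= x + theta < 1 -> rotation theta x = x + theta.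
Proof.
move=> h; rewrite /rotation (_ : Num.floor _ = 0) ?subr0//.
by apply: floor_def; rewrite add0r.
Qed.

Lemma rotation_ge1 (R : realType) (theta x : R) :
  1 <= x + theta < 2 -> rotation theta x = x + theta - 1.
Proof.
by move=> h; rewrite /rotation (_ : Num.floor _ = 1)//; apply: floor_def.
Qed.

Lemma rotation_itv (R : realType) (theta x : R) : 0 <= rotation theta x < 1.
Proof.
rewrite /rotation; have := floor_le_tmp (x + theta).
have := floorD1_gt (x + theta); rewrite intrD; lra.
Qed.

Lemma birkhoff_sum0 (R : realType) (theta x : R) : birkhoff_sum theta 0 x = 0.
Proof. by rewrite /birkhoff_sum big_geq. Qed.

Lemma birkhoff_sumS (R : realType) (theta x : R) n :
  birkhoff_sum theta n.+1 x =
  birkhoff_sum theta n x + circle_f (iter n (rotation theta) x).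
Proof. by rewrite /birkhoff_sum big_nat_recr. Qed.

Lemma birkhoff_sumD (R : realType) (theta x : R) m n :
  birkhoff_sum theta (m + n) x =
  birkhoff_sum theta m x + birkhoff_sum theta n (iter m (rotation theta) x).
Proof.
elim: n => [|n IH]; first by rewrite addn0 birkhoff_sum0 addr0.
by rewrite addnS !birkhoff_sumS IH -iterD (addnC n) -addrA.
Qed.

Lemma birkhoff_sum1 (R : realType) (theta x : R) :
  birkhoff_sum theta 1 x = circle_f x.
Proof. by rewrite birkhoff_sumS birkhoff_sum0 add0r. Qed.

(** * Single turns of the circle *)

Lemma iter_rotation_arc (R : realType) (theta y : R) j :
  0 <= y -> 0 < theta -> y + j%:R * theta < 1 ->
  iter j (rotation theta) y = y + j%:R * theta.
Proof.
move=> y0 t0; elim: j => [|j IH]; first by rewrite mul0r addr0.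
rewrite -natr1 mulrDl mul1r addrA => h /=.
have jt : 0 <= j%:R * theta by rewrite mulr_ge0// ltW.
by rewrite IH ?rotation_lt1//; lra.
Qed.

(** Exactly the first [c] points of the arc lie in [0, 1/2]; the later ones contribute -1. *)
Lemma birkhoff_sum_arc (R : realType) (theta y : R) c j :
  0 <= y -> 0 < theta ->
  y + c%:R * theta - theta <= 2^-1 < y + c%:R * theta ->
  y + j%:R * theta - theta < 1 ->
  birkhoff_sum theta j y = 2 * (minn j c)%:R - j%:R.
Proof.
move=> y0 t0 /andP[c1 c2].
elim: j => [|j IH]; first by rewrite min0n birkhoff_sum0 mulr0 subr0.
rewrite -natr1 mulrDl mul1r addrA addrK => h.
have jt : 0 <= j%:R * theta by rewrite mulr_ge0// ltW.
rewrite birkhoff_sumS IH ?iter_rotation_arc ?circle_fE//; [|lra..].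
case: (ltnP j c) => jc.
  have : j.+1%:R * theta <= c%:R * theta by rewrite ler_pM2r// ler_nat.
  rewrite -natr1 mulrDl mul1r => jcR.
  rewrite ifT; last lra.
  by rewrite (minn_idPl jc) -natr1; lra.
have : c%:R * theta <= j%:R * theta by rewrite ler_pM2r// ler_nat.
move=> cjR; rewrite ifF; last lra.
by rewrite (minn_idPr (leqW jc)); lra.
Qed.

(* The orbit of [y] makes one turn of the circle in [2 * k + (y < delta)]
   steps, of which [k + (y <= delta / 2)] fall in [0, 1/2]. *)
Lemma even_turn (R : realType) (theta delta y : R) k :
  (0 < k)%N -> 1 = 2 * k%:R * theta + delta ->
  0 < delta < theta -> 0 <= y < theta ->
  (forall j, (j <= 2 * k + (y < delta)%R)%N ->
    birkhoff_sum theta j y =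
    2 * (minn j (k + (y <= delta / 2)%R))%:R - j%:R) /\
  iter (2 * k + (y < delta)%R) (rotation theta) y =
    y - delta + (y < delta)%R%:R * theta.
Proof.
move=> k0 e /andP[d0 dt] /andP[y0 yt]; have t0 : 0 < theta by lra.
have turn : y + (2 * k + (y < delta)%R)%:R * theta =
    1 + (y - delta + (y < delta)%R%:R * theta).
  by rewrite natrD natrM; lra.
split=> [j jL|].
  apply: birkhoff_sum_arc => //.
    by rewrite natrD; case: (leP y (delta / 2)) => h /=; lra.
  apply: (@le_lt_trans _ _ (y + (2 * k + (y < delta)%R)%:R * theta - theta)).
    by rewrite lerB// lerD// ler_pM2r// ler_nat.
  by rewrite turn; case: (ltP y delta) => h /=; lra.
have : (0 < 2 * k + (y < delta)%R)%N by lia.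
case: (2 * k + _)%N turn => // L; rewrite -natr1 mulrDl mul1r => turn _ /=.
have kt : theta <= k%:R * theta by rewrite ler_peMl ?ler1n// ltW.
by rewrite iter_rotation_arc ?rotation_ge1 //; move: turn;
  case: (ltP y delta) => h /=; lra.
Qed.

(** A turn from a point of [[delta, theta[] has [k] points in [0, 1/2], then [k] beyond: its sum is
    0, no partial sum is negative, and the next turn starts [delta] lower. *)
Lemma zero_turns (R : realType) (theta delta y : R) k r :
  (0 < k)%N -> 1 = 2 * k%:R * theta + delta ->
  0 < delta < theta -> 0 <= y < theta -> r%:R * delta <= y ->
  [/\ forall j, (j <= 2 * k * r)%N -> 0 <= birkhoff_sum theta j y,
      birkhoff_sum theta (2 * k * r) y = 0 &
      iter (2 * k * r) (rotation theta) y = y - r%:R * delta].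
Proof.
move=> k0 e hd; have /andP[d0 dt] := hd.
elim: r y => [|r IH] y hy; have /andP[y0 yt] := hy.
  move=> _; rewrite muln0 birkhoff_sum0 mul0r subr0; split=> // j.
  by rewrite leqn0 => /eqP ->; rewrite birkhoff_sum0.
rewrite -natr1 mulrDl mul1r => ry.
have rd : 0 <= r%:R * delta by rewrite mulr_ge0// ltW.
have [] := even_turn k0 e hd hy.
have -> : (y < delta) = false by lra.
have -> : (y <= delta / 2) = false by lra.
rewrite !addn0 mul0r addr0 => S1 T1.
have S1k : birkhoff_sum theta (2 * k) y = 0.
  by rewrite S1// (minn_idPr _) ?natrM ?subrr//; lia.
have [||S2 S2k T2] := IH (y - delta); [lra..|].
rewrite mulnS; split=> [j jL||].
- have [jk|kj] := leqP j (2 * k).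
    rewrite S1// subr_ge0 -natrM ler_nat.
    by rewrite minnE; move: jk; clear; lia.
  have -> : j = (2 * k + (j - 2 * k))%N by rewrite subnKC// ltnW.
  by rewrite birkhoff_sumD S1k add0r T1 S2// leq_subLR.
- by rewrite birkhoff_sumD S1k add0r T1.
- by rewrite addnC iterD T1 T2; lra.
Qed.

(** * First return to [[0, delta[] *)

(** An excursion is one turn of [2 * k + 1] steps, which carries the whole sum, then [r] turns of
    sum 0 that bring [y] below [delta]. *)
Lemma first_return (R : realType) (theta delta t u : R) k m :
  (0 < k)%N -> 1 = 2 * k%:R * theta + delta ->
  (0 < m)%N -> theta = delta * (m%:R + t) ->
  0 < delta -> 0 < t < 1 -> 0 <= u < 1 ->
  exists L, [/\ (1 < L)%N,
    iter L (rotation theta) (delta * u) = delta * rotation t u,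
    birkhoff_sum theta L (delta * u) = circle_f u &
    forall j, (0 < j < L)%N ->
      circle_f u <= birkhoff_sum theta j (delta * u)].
Proof.
move=> k0 e m0 e' d0 /andP[t0 t1] hu; have /andP[u0 u1] := hu.
have m1 : 1 <= m%:R :> R by rewrite ler1n.
have dt : delta < theta by rewrite e' ltr_pMr//; lra.
have du0 : 0 <= delta * u by rewrite mulr_ge0// ltW.
have du1 : delta * u < delta by rewrite gtr_pMr.
have [||] := @even_turn _ theta delta (delta * u) k k0 e; [lra..|].
have -> : (delta * u < delta) = true by [].
have -> : (delta * u <= delta / 2) = (u <= 2^-1) by rewrite ler_pM2l.
rewrite mul1r => S1 T1.
set y := delta * u - delta + theta in T1.
have [r [ry rE]] : exists r : nat, r%:R * delta <= y /\
    y - r%:R * delta = delta * rotation t u.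
  (* Since [y = delta * (u + t + m - 1)], the number of subtractions of [delta] depends on whether
     [u + t] passes 1. *)
  have [ut|ut] := ltP (u + t) 1; [exists m.-1|exists m].
    have -> : m.-1%:R = m%:R - 1 :> R by rewrite -subn1 natrB.
    have dut : 0 <= delta * (u + t) by rewrite mulr_ge0 ?(ltW d0)//; lra.
    by rewrite rotation_lt1 ?/y ?e'; lra.
  have dut : delta * 1 <= delta * (u + t) by rewrite ler_pM2l.
  by rewrite rotation_ge1 ?/y ?e'; lra.
have [||S2 S2L T2] := @zero_turns _ theta delta y k r k0 e _ _ ry;
  [lra|rewrite /y; lra|].
have S1L : birkhoff_sum theta (2 * k + 1) (delta * u) = circle_f u.
  rewrite S1// circle_fE// !(natrD, natrM); case: (u <= 2^-1) => /=.
    by rewrite (minn_idPr _) ?natrD; [lra|lia].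
  by rewrite (minn_idPr _) ?natrD; [lra|lia].
exists (2 * k + 1 + 2 * k * r)%N; split.
- lia.
- by rewrite addnC iterD T1 T2 rE.
- by rewrite birkhoff_sumD T1 S2L addr0 S1L.
(* Before the long turn ends, the sums are at least 1 if [u <= 2^-1] and at least 0 otherwise. *)
move=> j /andP[j0 jL]; have [jk|kj] := leqP j (2 * k).
  rewrite S1; last lia.
  rewrite circle_fE//; move: jk j0; clear.
  case: (u <= 2^-1) => /= jk j0.
    have : j%:R + 1 <= 2 * (minn j (k + 1))%:R :> R.
      by rewrite natr1 -natrM ler_nat minnE; lia.
    by lra.
  have : j%:R <= 2 * (minn j (k + 0))%:R :> R.
    by rewrite -natrM ler_nat minnE; lia.
  by lra.
have -> : j = (2 * k + 1 + (j - (2 * k + 1)))%N by lia.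
rewrite birkhoff_sumD S1L T1.
by rewrite lerDl S2//; lia.
Qed.

(** Concatenate [j] excursions. As none is empty, [j <= n], so a positive time stays positive. *)
Lemma return_times (R : realType) (theta delta t : R) k m :
  (0 < k)%N -> 1 = 2 * k%:R * theta + delta ->
  (0 < m)%N -> theta = delta * (m%:R + t) ->
  0 < delta -> 0 < t < 1 ->
  forall j u, 0 <= u < 1 -> exists2 n, (j <= n)%N &
    birkhoff_sum theta n (delta * u) = birkhoff_sum t j u.
Proof.
move=> k0 e m0 e' d0 ht; elim=> [|j IH] u hu.
  by exists 0%N; rewrite ?birkhoff_sum0.
have [L [L1 TL SL _]] := first_return k0 e m0 e' d0 ht hu.
have [n jn Sn] := IH _ (rotation_itv t u).
exists (L + n)%N; first lia.
by rewrite birkhoff_sumD SL TL Sn -add1n birkhoff_sumD birkhoff_sum1.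
Qed.

(** The last excursion, possibly cut short, has sum at least its total. Each full one lasts at least
    two steps, whence the bound [n.+1./2], which is below [n] once [1 < n] and so permits induction
    on time. *)
Lemma birkhoff_sum_ge_return (R : realType) (theta delta t : R) k m :
  (0 < k)%N -> 1 = 2 * k%:R * theta + delta ->
  (0 < m)%N -> theta = delta * (m%:R + t) ->
  0 < delta -> 0 < t < 1 ->
  forall n u, 0 <= u < 1 -> (0 < n)%N -> exists2 j, (0 < j <= n.+1./2)%N &
    birkhoff_sum t j u <= birkhoff_sum theta n (delta * u).
Proof.
move=> k0 e m0 e' d0 ht; elim/ltn_ind=> n IH u hu n0.
have [L [L1 TL SL SjL]] := first_return k0 e m0 e' d0 ht hu.
have [nL|Ln|nL] := ltngtP n L.
- by exists 1%N; first lia; rewrite birkhoff_sum1 SjL// n0.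
- have [||j /andP[j0 jn] Sj] := IH (n - L)%N _ _ (rotation_itv t u); [lia..|].
  exists j.+1; first lia.
  rewrite -(subnKC (ltnW Ln)) -add1n !birkhoff_sumD birkhoff_sum1 SL TL.
  by rewrite lerD2l.
- by exists 1%N; first lia; rewrite birkhoff_sum1 nL SL.
Qed.

(** * Obstructions to heaviness *)

Lemma heavy_lt_delta (R : realType) (theta delta x : R) k :
  (0 < k)%N -> 1 = 2 * k%:R * theta + delta -> 0 < delta < theta ->
  strictly_heavy theta x -> x < delta.
Proof.
move=> k0 e hd [/andP[x0 x1] Sx]; have /andP[d0 dt] := hd.
have t0 : 0 < theta by lra.
rewrite ltNge; apply/negP => dx.
(* The turn through [x] starts at [y], and [x] is its point of index [j]. *)
pose j := Num.truncn (x / theta).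
have /andP[] := truncn_itv (divr_ge0 x0 (ltW t0)); rewrite -/j.
rewrite ler_pdivlMr// ltr_pdivrMr// -natr1 mulrDl mul1r => jx xj.
pose y := x - j%:R * theta.
have hy : 0 <= y < theta by rewrite /y; lra.
have [S1 _] := even_turn k0 e hd hy.
have yj : x = iter j (rotation theta) y.
  by rewrite iter_rotation_arc; rewrite /y; lra.
set b := (y < delta)%R in S1; set c := (y <= delta / 2)%R in S1.
have cb : (c <= b)%N.
  by rewrite /c /b; case: (ltP y delta) => h /=; case: leP => //; lra.
(* The start of a long turn must be excluded: its total may be 1, above the empty sum. *)
have jb : (b <= j)%N.
  rewrite /b; case: (ltP y delta) => //= h; rewrite lt0n; apply/eqP => j0.
  by move: h; rewrite /y j0; lra.
have jL : (j < 2 * k + b)%N.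
  rewrite ltnNge; apply/negP; rewrite -(ler_nat R) natrD natrM => h.
  have : (2 * k%:R + b%:R) * theta <= j%:R * theta by rewrite ler_pM2r.
  rewrite /b /y; case: (ltP y delta) => hyd /=; move: hyd; rewrite /y; lra.
(* Heaviness makes the rest of the turn positive, but the first [j] steps already sum to at least
   the total. *)
have := Sx (2 * k + b - j)%N; rewrite subn_gt0 jL => /(_ isT).
have : birkhoff_sum theta (2 * k + b) y <= birkhoff_sum theta j y.
  rewrite !S1//; last exact: ltnW.
  have : 2 * (minn (2 * k + b) (k + c))%:R + j%:R <=
         2 * (minn j (k + c))%:R + (2 * k + b)%:R :> R.
    by rewrite -!natrM -!natrD ler_nat !minnE; move: cb jb jL; clear; lia.
  by lra.
rewrite -{1}(subnKC (ltnW jL)) birkhoff_sumD -yj; lra.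
Qed.

Lemma zero_not_heavy_odd (R : realType) (theta delta : R) k :
  1 = (2 * k%:R + 1) * theta + delta -> 0 < delta < theta ->
  ~ strictly_heavy theta 0.
Proof.
move=> e /andP[d0 dt] [_ /(_ (2 * k.+1)%N isT)].
(* As [k * theta = (1 - theta - delta) / 2], the points of index [k] and [k + 1] are on either side
   of 1/2, and the [2 * k + 2] points split evenly. *)
rewrite (@birkhoff_sum_arc _ theta 0 k.+1) //; last 3 first.
- by lra.
- by rewrite -natr1; lra.
- by rewrite natrM -natr1; lra.
by rewrite (minn_idPr _) ?natrM ?subrr ?ltxx//; lia.
Qed.

(** * Tails of the continued fraction *)

Lemma cfrac_from_itv (R : realType) (a : nat -> nat) :
  (forall i, (1 <= i)%N -> (1 <= a i)%N) ->
  forall n k, (1 <= k)%N -> 0 <= (cfrac_from a k n : R) <= 1.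
Proof.
move=> a1; elim=> [|n IH] k k1 /=; first by rewrite lexx ler01.
have /andP[c0 _] := IH k.+1 isT.
have ak : 1 <= (a k)%:R :> R by rewrite ler1n a1.
by rewrite invr_ge0 invf_le1; lra.
Qed.

(** Irrationality is carried along to exclude 0 and 1, which the limit of the next tail alone leaves
    possible. *)
Definition cfrac_tail (R : realType) (a : nat -> nat) (k : nat) (theta : R) :=
  [/\ 0 < theta < 1, irrational theta &
      (fun n => cfrac_from a k n : R) @ \oo --> theta].

Lemma cfrac_tailS (R : realType) (a : nat -> nat) (k : nat) (theta : R) :
  (forall i, (1 <= i)%N -> (1 <= a i)%N) -> (1 <= k)%N ->
  cfrac_tail a k theta ->
  exists2 t, cfrac_tail a k.+1 t & 1 = theta * ((a k)%:R + t).
Proof.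
move=> a1 k1 [/andP[th0 th1] irr cv].
have thn0 : theta != 0 by rewrite gt_eqF.
pose t := theta^-1 - (a k)%:R.
have cvt : (fun n => cfrac_from a k.+1 n : R) @ \oo --> t.
  move: cv; rewrite -cvg_shiftS /= => /(cvgV thn0) cv.
  have -> : (fun n => cfrac_from a k.+1 n : R) =
      (fun n => ((a k)%:R + cfrac_from a k.+1 n)^-1^-1 - (a k)%:R).
    by apply/funext => n; rewrite invrK addrC addKr.
  exact: cvgB cv (cvg_cst _).
have tE : 1 = theta * ((a k)%:R + t) by rewrite /t subrKC mulfV.
have t_irr : irrational t.
  move=> [q _ qt]; apply: irr; exists ((a k)%:R + q)^-1 => //.
  rewrite fmorphV rmorphD /= ratr_nat qt /t subrKC invrK//.
exists t => //; split=> //.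
have tge0 : 0 <= t.
  apply: (cvgr_to_ge cvt); apply: nearW => n.
  by have /andP[] := cfrac_from_itv R a1 n (ltn0Sn k).
have tle1 : t <= 1.
  apply: (cvgr_to_le cvt); apply: nearW => n.
  by have /andP[] := cfrac_from_itv R a1 n (ltn0Sn k).
rewrite !lt_neqAle tge0 tle1 !andbT; apply/andP; split; apply/eqP => tq.
  by apply: t_irr; exists 0 => //; rewrite -tq rmorph0.
by apply: t_irr; exists 1 => //; rewrite tq rmorph1.
Qed.

(** Two steps of the Gauss map; [delta] is [theta] times the intermediate tail [s]. *)
Lemma cfrac_tail_renorm (R : realType) (a : nat -> nat) (k : nat) (theta : R) :
  (forall i, (1 <= i)%N -> (1 <= a i)%N) -> (1 <= k)%N ->
  cfrac_tail a k theta ->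
  exists delta t, [/\ cfrac_tail a k.+2 t, 0 < delta < theta,
    1 = (a k)%:R * theta + delta & theta = delta * ((a k.+1)%:R + t)].
Proof.
move=> a1 k1 H; have [/andP[th0 _] _ _] := H.
have [s Hs sE] := cfrac_tailS a1 k1 H; have [/andP[s0 s1] _ _] := Hs.
have [t Ht tE] := cfrac_tailS a1 (ltn0Sn k) Hs.
exists (theta * s), t; split=> //; last by rewrite -mulrA -tE mulr1.
  by rewrite mulr_gt0// gtr_pMr.
by rewrite {1}sE; ring.
Qed.

Lemma cfrac_tail_even (R : realType) (a : nat -> nat) (k : nat) (theta : R) :
  (forall i, (1 <= i)%N -> (1 <= a i)%N) -> (1 <= k)%N ->
  cfrac_tail a k theta -> ~~ odd (a k) ->
  exists delta t, [/\ cfrac_tail a k.+2 t, 0 < delta < theta, (0 < (a k)./2)%N,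
    1 = 2 * (a k)./2%:R * theta + delta & theta = delta * ((a k.+1)%:R + t)].
Proof.
move=> a1 k1 H ev; have [delta [t [Ht hd e e']]] := cfrac_tail_renorm a1 k1 H.
exists delta, t; split=> //; first by have := a1 k k1; lia.
by rewrite -natrM mul2n even_halfK.
Qed.

(** * Descent through every second tail *)

Lemma zero_heavy_tail (R : realType) (a : nat -> nat) (k : nat) (theta : R) :
  (forall i, (1 <= i)%N -> (1 <= a i)%N) -> (1 <= k)%N ->
  cfrac_tail a k theta -> strictly_heavy theta 0 ->
  ~~ odd (a k) /\
  exists2 t, cfrac_tail a k.+2 t & strictly_heavy t (0 : R).
Proof.
move=> a1 k1 H heavy0.
have ev : ~~ odd (a k).
  have [delta [t [_ hd e _]]] := cfrac_tail_renorm a1 k1 H.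
  apply/negP => ak; apply: (@zero_not_heavy_odd _ theta delta (a k)./2) => //.
  have <- : (a k)%:R = 2 * (a k)./2%:R + 1 :> R => //.
  by rewrite -natrM natr1; congr (_%:R); lia.
split=> //.
have [delta [t [Ht hd h0 e e']]] := cfrac_tail_even a1 k1 H ev.
have [ht _ _] := Ht; have /andP[d0 _] := hd.
exists t => //; split=> [|n n1]; first by rewrite lexx ltr01.
have [|N nN <-] := return_times h0 e (a1 _ (ltn0Sn k)) e' d0 ht n (u := 0).
  by rewrite lexx ltr01.
by rewrite mulr0; case: heavy0 => _; apply; apply: leq_trans nN.
Qed.

Lemma even_of_zero_heavy (R : realType) (a : nat -> nat) :
  (forall i, (1 <= i)%N -> (1 <= a i)%N) ->
  forall i k (theta : R), (1 <= k)%N -> cfrac_tail a k theta ->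
  strictly_heavy theta 0 -> ~~ odd (a (2 * i + k)%N).
Proof.
move=> a1; elim=> [|i IH] k theta k1 H heavy0.
  by have [] := zero_heavy_tail a1 k1 H heavy0.
have [_ [t Ht heavyt]] := zero_heavy_tail a1 k1 H heavy0.
have -> : (2 * i.+1 + k = 2 * i + k.+2)%N by lia.
exact: IH Ht heavyt.
Qed.

(** Induction on time, for all tails at once: renormalization bounds the sum below by one for [t] at
    a smaller positive time. *)
Lemma birkhoff_sum_zero_gt0 (R : realType) (a : nat -> nat) :
  (forall i, (1 <= i)%N -> (1 <= a i)%N) ->
  forall n k (theta : R), (1 <= k)%N -> cfrac_tail a k theta ->
  (forall i, ~~ odd (a (2 * i + k)%N)) ->
  (0 < n)%N -> 0 < birkhoff_sum theta n 0.
Proof.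
move=> a1; elim/ltn_ind=> n IH k theta k1 H ev n0.
have [n1|n1] := leqP n 1.
  have -> : n = 1%N by lia.
  by rewrite birkhoff_sum1 circle_fE ?lexx ?ltr01// invr_ge0 ler0n.
have [delta [t [Ht hd h0 e e']]] := cfrac_tail_even a1 k1 H (ev 0%N).
have [ht _ _] := Ht; have /andP[d0 _] := hd.
have [||j /andP[j0 jn] Sj] :=
    birkhoff_sum_ge_return h0 e (a1 _ (ltn0Sn k)) e' d0 ht (n := n) (u := 0).
- by rewrite lexx ltr01.
- by [].
move: Sj; rewrite mulr0; apply: lt_le_trans.
apply: (IH j _ k.+2 t) => //; first lia.
by move=> i; have := ev i.+1;
  rewrite (_ : 2 * i.+1 + k = 2 * i + k.+2)%N//; lia.
Qed.

(** Each renormalization at least doubles a heavy point and keeps it heavy, hence below 1. *)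
Lemma heavy_lt_expr (R : realType) (a : nat -> nat) :
  (forall i, (1 <= i)%N -> (1 <= a i)%N) ->
  forall n k (theta x : R), (1 <= k)%N -> cfrac_tail a k theta ->
  (forall i, ~~ odd (a (2 * i + k)%N)) ->
  strictly_heavy theta x -> x * 2 ^+ n < 1.
Proof.
move=> a1; elim=> [|n IH] k theta x k1 H ev hx.
  by rewrite mulr1; case: hx => /andP[].
have [delta [t [Ht hd h0 e e']]] := cfrac_tail_even a1 k1 H (ev 0%N).
have [ht _ _] := Ht; have /andP[d0 dt] := hd.
have xd := heavy_lt_delta h0 e hd hx.
have [/andP[x0 x1] Sx] := hx.
have xE : x = delta * (x / delta) by rewrite mulrC divfK// gt_eqF.
have hu : 0 <= x / delta < 1.
  by rewrite divr_ge0 ?(ltW d0)//= ltr_pdivrMr// mul1r.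
have heavyu : strictly_heavy t (x / delta).
  split=> // j j1.
  have [N jN <-] := return_times h0 e (a1 _ (ltn0Sn k)) e' d0 ht j hu.
  by rewrite -xE; apply: Sx; apply: leq_trans jN.
have d2 : delta * 2 <= 1.
  have : theta <= (a k)./2%:R * theta by rewrite ler_peMl ?ler1n//; lra.
  lra.
have un : (x / delta) * 2 ^+ n < 1.
  apply: (IH k.+2 t) => // i.
  by have := ev i.+1;
    rewrite (_ : 2 * i.+1 + k = 2 * i + k.+2)%N//; lia.
rewrite xE exprS mulrACA; apply: le_lt_trans un.
by rewrite ler_piMl// mulr_ge0 ?exprn_ge0//; case/andP: hu.
Qed.

Unset Implicit Arguments.
Set Strict Implicit.

Theorem corollary1p0p1 (R : realType) (theta : R) (a : nat -> nat)
  (htheta : 0 < theta < 1) (hirr : irrational theta)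
  (ha : has_cfrac theta a) :
  strictly_heavy theta = [set 0] <->
  (forall i : nat, ~~ odd (a (2 * i + 1)%N)).
Proof.
have [a1 cv] := ha; have H : cfrac_tail a 1 theta by [].
split=> [E i|ev].
  by apply: (even_of_zero_heavy a1 i (isT : 0 < 1)%N H); rewrite E.
apply/seteqP; split=> [x hx|_ ->] /=; last first.
  split=> [|n]; first by rewrite lexx ltr01.
  exact: (birkhoff_sum_zero_gt0 a1 (isT : 0 < 1)%N H).
have [/andP[x0 _] _] := hx.
apply/eqP; rewrite eq_le x0 andbT leNgt; apply/negP => xp.
(* This exponent makes the power of 2 exceed [x^-1]. *)
have := heavy_lt_expr a1 (Num.bound x^-1) (isT : 0 < 1)%N H ev hx.
apply/negP; rewrite -leNgt -ler_pdivrMl// mulr1 ltW//.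
exact: upper_nthrootP.
Qed.
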